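(* There exists no generalized hexagon of order $(2,t)$ containing $H(2)$ as an isometrically embedded proper subgeometry.
   Context: A generalized hexagon is a partial linear space whose collinearity graph is connected of diameter $3$, such that every point $x$ and line $L$ have a unique point on $L$ nearest to $x$, every point is on at least two lines, and any two points at distance $2$ have a unique common neighbour. Order $(2,t)$ means three points per line and $t+1$ lines through each point ($t$ possibly infinite). A subgeometry is isometrically embedded if its distances coincide with those of the ambient geometry. $H(2)$ is the split Cayley generalized hexagon of order $2$. *)

(* Defs.v *)
From HB Require Import structures.
From mathcomp Require Import all_boot all_order all_algebra all_field.
From mathcomp Require Import all_classical.

Set Implicit Arguments.
Unset Strict Implicit.
Unset Printing Implicit Defensive.

Import GRing.Theory.

Local Open Scope classical_set_scope.
Local Open Scope card_scope.

Record geometry : Type := Geometry {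
  gpoint : Type;
  gline : Type;
  inc : gpoint -> gline -> Prop }.

Section Geometry.
Variable G : geometry.
Implicit Types (x y z : gpoint G) (L M : gline G).

(** Adjacency in the collinearity graph. *)
Definition collinear x y : Prop :=
  x <> y /\ exists L, inc x L /\ inc y L.

Fixpoint walk (n : nat) x y : Prop :=
  if n is m.+1 then exists z, collinear x z /\ walk m z y else x = y.

(** [dist x y n]: the distance between [x] and [y] in the collinearity graph
    is finite and equal to [n]. *)
Definition dist x y (n : nat) : Prop :=
  walk n x y /\ forall m, walk m x y -> n <= m.

Definition connected_geometry : Prop := forall x y, exists n, walk n x y.

Definition diameter (d : nat) : Prop :=
  (forall x y n, dist x y n -> n <= d) /\ exists x y, dist x y d.

Definition nearest x L y : Prop :=
  inc y L /\ forall z m n, inc z L -> dist x y m -> dist x z n -> m <= n.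

Definition partial_linear_space : Prop :=
  (forall L, exists x y, x <> y /\ inc x L /\ inc y L) /\
  (forall x y L M, x <> y ->
     inc x L -> inc y L -> inc x M -> inc y M -> L = M).

Definition generalized_hexagon : Prop :=
  [/\ partial_linear_space,
      connected_geometry /\ diameter 3,
      forall x L, exists! y, nearest x L y,
      forall x, exists L M, L <> M /\ inc x L /\ inc x M &
      forall x y, dist x y 2 -> exists! z, collinear x z /\ collinear z y].

(** Order [(s, t)], where [t = None] encodes an infinite [t]. *)
Definition has_order (s : nat) (t : option nat) : Prop :=
  (forall L, [set x | inc x L] #= `I_s.+1) /\
  (forall x, match t return Prop with
             | Some k => [set L | inc x L] #= `I_k.+1
             | None => infinite_set [set L | inc x L]
             end).

Section Subgeometry.
Variables (X : set (gpoint G)) (Y : set (gline G)).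

Definition subgeometry : geometry :=
  {| gpoint := X; gline := Y;
     inc := fun (x : X) (L : Y) => inc (val x) (val L) |}.

Definition proper_subgeometry : Prop := ~ (X = setT /\ Y = setT).

End Subgeometry.

End Geometry.

Definition isometrically_embedded (G : geometry)
    (X : set (gpoint G)) (Y : set (gline G)) : Prop :=
  forall (x y : gpoint (subgeometry X Y)) (n : nat),
    dist x y n <-> dist (val x : gpoint G) (val y : gpoint G) n.

Definition isomorphic (G H : geometry) : Prop :=
  exists (f : gpoint G -> gpoint H) (g : gline G -> gline H),
    [/\ bijective f, bijective g & forall x L, inc x L <-> inc (f x) (g L)].

Section SplitCayley.
Variable F : finFieldType.
Implicit Types (x y : 'rV[F]_7) (U V : {vspace 'rV[F]_7}).
Local Open Scope ring_scope.

Definition coor x (i : nat) : F := x ord0 (inord i).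

(** The quadric Q(6, q): X0 X4 + X1 X5 + X2 X6 = X3 ^ 2. *)
Definition on_Q6 x : bool :=
  coor x 0 * coor x 4 + coor x 1 * coor x 5 + coor x 2 * coor x 6
    == coor x 3 ^+ 2.

Definition grassmann x y (i j : nat) : F :=
  coor x i * coor y j - coor x j * coor y i.

(** Tits' equations for the lines of the split Cayley hexagon. *)
Definition tits_equations x y : bool :=
  let p := grassmann x y in
  [&& p 1%N 2%N == p 3%N 4%N, p 5%N 4%N == p 3%N 2%N,
      p 2%N 0%N == p 3%N 5%N, p 6%N 5%N == p 3%N 0%N,
      p 0%N 1%N == p 3%N 6%N & p 4%N 6%N == p 3%N 1%N].

Definition is_cayley_point U : bool :=
  (\dim U == 1)%N && [forall x, (x \in U) ==> on_Q6 x].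

(** The Grassmann coordinates of two vectors of a plane [V] are a multiple of
    those of any basis of [V], so asking Tits' equations of every pair in [V]
    is asking them of the projective line [V]. *)
Definition is_cayley_line V : bool :=
  [&& (\dim V == 2)%N, [forall x, (x \in V) ==> on_Q6 x] &
      [forall x, forall y, (x \in V) && (y \in V) ==> tits_equations x y]].

Definition split_cayley : geometry :=
  {| gpoint := {U : {vspace 'rV[F]_7} | is_cayley_point U};
     gline := {V : {vspace 'rV[F]_7} | is_cayley_line V};
     inc := fun p L => (val p <= val L)%VS |}.

End SplitCayley.

Definition H2 : geometry := split_cayley 'F_2.

(* Main.v *)
(** Let [x] be a point outside the subhexagon [H = H(2)], collinear with the
    point [y] of [H]. A point outside [H] has at most one neighbour in [H]: two
    of them would have [x] and a point of [H] as common neighbours, or form a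
    triangle with [x]. Hence the points of [H] at distance 3 from [y] are at
    distance 2 or 3 from [x], and these two values alternate along the edges of
    the collinearity graph on them, since each such edge lies on a line whose
    third point is at distance 3 from [x]. Pick [w] among them at distance 2
    from [x], let [u] be the common neighbour of [x] and [w] (it is not in [H]),
    and let [v] be the third point of the line [xu]. A point of [H] at distance
    2 from both [x] and [u] is collinear with [v], so there is at most one. But
    in [H(2)] at least two points are joined to [w] by a walk of length 4 in the
    graph attached to [y] and to [y] by a walk of length 4 in the graph attached
    to [w]; this is checked by computation on coordinates over [F_2]. *)

Require Import Defs.
From mathcomp Require Import all_boot all_algebra.
From mathcomp Require Import all_classical.

Set Implicit Arguments.
Unset Strict Implicit.
Unset Printing Implicit Defensive.

Local Open Scope classical_set_scope.
Local Open Scope card_scope.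

Import GRing.Theory.

(** * Distances in the collinearity graph and nearest points on lines *)

Section Distance.
Variable G : geometry.
Implicit Types (x y z : gpoint G) (L : gline G).

Lemma collinear_sym x y : collinear x y -> collinear y x.
Proof. by move=> [ne [L [xL yL]]]; split; [exact: nesym | exists L]. Qed.

Lemma walk_cat m n x y z : walk m x y -> walk n y z -> walk (m + n) x z.
Proof.
elim: m x => [|m IH] x /=; first by move=> ->.
by move=> [u [xu uy]] yz; exists u; split=> //; apply: IH.
Qed.

Lemma walk1 x y : walk 1 x y <-> collinear x y.
Proof.
split=> [[z [xz zy]]|xy]; last by exists y.
by move: xz; rewrite (zy : z = y).
Qed.

Lemma walk_sym n x y : walk n x y -> walk n y x.
Proof.
elim: n x => [|n IH] x; first by move=> ->.
move=> [z [xz zy]]; rewrite -addn1.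
by apply: walk_cat (IH _ zy) _; apply/walk1/collinear_sym.
Qed.

Hypothesis conn : connected_geometry G.

Let ex_walk x y : exists n, `[< walk n x y >].
Proof. by have [n xy] := conn x y; exists n; apply/asboolP. Qed.

(** The relation [dist] turned into a function, so that distances can be rewritten and compared;
    connectedness makes the minimum exist. *)
Definition gdist x y : nat := ex_minn (ex_walk x y).

Lemma gdist_walk x y : walk (gdist x y) x y.
Proof. by rewrite /gdist; case: ex_minnP => n /asboolP. Qed.

Lemma gdist_le n x y : walk n x y -> gdist x y <= n.
Proof.
by rewrite /gdist; case: ex_minnP => m _ min xy; apply/min/asboolP.
Qed.

Lemma distP x y n : dist x y n <-> gdist x y = n.
Proof.
split=> [[xy min]|<-]; last by split=> [|m]; [exact: gdist_walk | exact: gdist_le].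
by apply/eqP; rewrite eqn_leq gdist_le // min //; exact: gdist_walk.
Qed.

Lemma gdist_sym x y : gdist x y = gdist y x.
Proof.
by apply/eqP; rewrite eqn_leq !gdist_le //; apply: walk_sym; exact: gdist_walk.
Qed.

Lemma gdist_triangle y x z : gdist x z <= gdist x y + gdist y z.
Proof. by apply: gdist_le; apply: walk_cat; exact: gdist_walk. Qed.

Lemma gdist0 x y : gdist x y = 0 -> x = y.
Proof. by move=> d0; have := gdist_walk x y; rewrite d0. Qed.

Lemma gdist1 x y : gdist x y = 1 <-> collinear x y.
Proof.
split=> [d1|xy]; first by apply/walk1; rewrite -d1; exact: gdist_walk.
apply/eqP; rewrite eqn_leq gdist_le ?lt0n; last exact/walk1.
by apply/eqP => /gdist0; case: xy.
Qed.

Hypothesis nearest_unique : forall x L, exists! y, nearest x L y.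

(** Otherwise [a] and [b] would both be nearest to [x] on [L], against uniqueness. *)
Lemma closer_on_line x L a b : a <> b -> inc a L -> inc b L ->
  gdist x a = gdist x b -> exists2 c, inc c L & gdist x c < gdist x a.
Proof.
move=> ab aL bL dab; apply/not_exists2P => noc.
have [m [_ uniq_m]] := nearest_unique x L.
have min c : inc c L -> gdist x a <= gdist x c.
  by move=> cL; case: (noc c) => // /negP; rewrite -leqNgt.
case: ab; transitivity m; [symmetry|]; apply: uniq_m; split=> // z k l zL.
  by move=> /distP <- /distP <-; exact: min.
by move=> /distP <- /distP <-; rewrite -dab; exact: min.
Qed.

End Distance.

Lemma hexagon_connected (G : geometry) :
  generalized_hexagon G -> connected_geometry G.
Proof. by case=> _ []. Qed.

Lemma hexagon_nearest (G : geometry) : generalized_hexagon G ->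
  forall (x : gpoint G) L, exists! y, nearest x L y.
Proof. by case. Qed.

(** * Points outside a full, isometrically embedded subgeometry *)

Section Embedding.
Variables (G : geometry) (X : set (gpoint G)) (Y : set (gline G)).
Hypotheses (hexG : generalized_hexagon G)
  (line3 : forall L : gline G, [set x | inc x L] #= `I_3)
  (iso : isometrically_embedded X Y)
  (full : forall L x, Y L -> inc x L -> X x).
Implicit Types (x y z p : gpoint G) (L : gline G).

Local Notation conn := (hexagon_connected hexG).
Local Notation near_unique := (hexagon_nearest hexG).
Local Notation d := (gdist conn).

Lemma gdist_le3 x y : d x y <= 3.
Proof.
have [_ [_ [le3 _]] _ _ _] := hexG.
by apply: (le3 x y); apply/(distP conn).
Qed.

Lemma line_points L a b : a <> b -> inc a L -> inc b L ->
  exists c, [/\ inc c L, c <> a, c <> b &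
    forall q, inc q L -> [\/ q = a, q = b | q = c]].
Proof.
move=> ab aL bL.
have /card_set_bijP[f [fimg finj fsurj]] := line3 L.
(* [i] is the index left over by [a] and [b]; its preimage is the third point. *)
have [i] : exists i : nat, (i < 3) && (i != f a) && (i != f b).
  by case: (f a) (f b) => [|[|[|k]]] [|[|[|l]]];
    first [by exists 0 | by exists 1 | by exists 2].
case/andP=> /andP[i3 ia] ib.
have [c cL fc] := fsurj i i3.
exists c; split=> //; [by move=> ca; rewrite -fc ca eqxx in ia|
                       by move=> cb; rewrite -fc cb eqxx in ib|].
move=> q qL; have fq := fimg q qL; have fa := fimg a aL; have fb := fimg b bL.
have fab : f a != f b.
  by apply/eqP => /finj e; apply: ab; apply: e; rewrite inE.
have [e|[e|e]] : f q = f a \/ f q = f b \/ f q = i.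
- move: fq fa fb fab ia ib i3; rewrite /= {fc}.
  by case: (f q) (f a) (f b) i => [|[|[|?]]] [|[|[|?]]] [|[|[|?]]] [|[|[|?]]] //;
    tauto.
- by apply: Or31; apply: finj e; rewrite inE.
- by apply: Or32; apply: finj e; rewrite inE.
- by apply: Or33; apply: finj; rewrite ?inE// fc.
Qed.

Lemma sub_collinear (x y : gpoint (subgeometry X Y)) :
  collinear x y -> exists L, [/\ Y L, inc (val x) L & inc (val y) L].
Proof.
move=> [_ [L [xL yL]]]; exists (val L); split=> //; exact: set_valP.
Qed.

Lemma collinear_line a b : X a -> X b -> collinear a b ->
  exists L, [/\ Y L, inc a L & inc b L].
Proof.
move=> Xa Xb ab.
pose a' : gpoint (subgeometry X Y) := exist _ a (mem_set Xa).
pose b' : gpoint (subgeometry X Y) := exist _ b (mem_set Xb).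
have /(iso a' b') [/walk1 /sub_collinear //] : dist a b 1.
by apply/(distP conn)/gdist1.
Qed.

(** By isometry the distance is already 2 inside the subgeometry, so the midpoint of a shortest walk
    can be taken in [X]. *)
Lemma common_neighbour a b : X a -> X b -> d a b = 2 ->
  exists2 c, X c & collinear a c /\ collinear c b.
Proof.
move=> Xa Xb ab.
pose a' : gpoint (subgeometry X Y) := exist _ a (mem_set Xa).
pose b' : gpoint (subgeometry X Y) := exist _ b (mem_set Xb).
have /(iso a' b') [[c [ac /walk1 cb]] _] : dist a b 2 by apply/(distP conn).
exists (val c); first exact: set_valP.
have [L [_ aL cL]] := sub_collinear ac.
have [M [_ cM bM]] := sub_collinear cb.
by split; split; [move: ac => [ne _] e; apply: ne; apply: val_inj | exists L
  | move: cb => [ne _] e; apply: ne; apply: val_inj | exists M].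
Qed.

(** Two points of [L] at distance 1 from [x] force a point of [L] at distance 0. *)
Lemma no_triangle x a b L : collinear x a -> collinear x b -> a <> b ->
  inc a L -> inc b L -> inc x L.
Proof.
move=> /(gdist1 conn) xa /(gdist1 conn) xb ab aL bL.
have := closer_on_line near_unique ab aL bL (etrans xa (esym xb)).
by rewrite xa => -[c cL]; rewrite ltnS leqn0 => /eqP /gdist0 ->.
Qed.

Lemma outside_neighbour_unique x a b : ~ X x -> X a -> X b ->
  collinear x a -> collinear x b -> a = b.
Proof.
move=> nX Xa Xb xa xb; apply: contrapT => ab.
have dab : d a b <= 2.
  apply: leq_trans (gdist_triangle conn x a b) _; rewrite gdist_sym.
  by move/(gdist1 conn): xa => ->; move/(gdist1 conn): xb => ->.
move: dab; rewrite leq_eqVlt => /orP[/eqP dab|].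
  have [c Xc [ac cb]] := common_neighbour Xa Xb dab.
  have [_ _ _ _ /(_ a b)[|m [_ uniq_m]]] := hexG; first exact/(distP conn).
  apply: nX; have <- : m = x by apply: uniq_m; split=> //; exact: collinear_sym.
  by have -> : m = c by exact: uniq_m.
rewrite ltnS leq_eqVlt => /orP[/eqP /gdist1 cab|].
  have [L [YL aL bL]] := collinear_line Xa Xb cab.
  by apply: nX; apply: full YL _; exact: no_triangle xa xb ab aL bL.
by rewrite ltnS leqn0 => /eqP /gdist0.
Qed.

Section Outside.
Variables (x y : gpoint G).
Hypotheses (nXx : ~ X x) (Xy : X y) (xy : collinear x y).

Lemma outside_gdist_ge2 p : X p -> p <> y -> 2 <= d x p.
Proof.
move=> Xp py; rewrite ltnNge leq_eqVlt; apply/negP => /orP[/eqP /gdist1 xp|].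
  by apply: py; exact: outside_neighbour_unique xp xy.
by rewrite ltnS leqn0 => /eqP /gdist0 e; apply: nXx; rewrite e.
Qed.

Lemma outside_gdist p : X p -> p <> y -> d x p = 2 \/ d x p = 3.
Proof.
move=> Xp py; have := outside_gdist_ge2 Xp py; have := gdist_le3 x p.
by case: (d x p) => [|[|[|[|]]]] //; tauto.
Qed.

(** The point [z] is at distance 2 from [x]. Were [s] also at distance 2, the line [zs] would carry
    a point of [X] closer to [x]. That point can only be [y], which would make [y] and [s]
    collinear. *)
Lemma outside_gdist3 z s : X z -> X s -> collinear y z -> collinear z s ->
  y <> s -> ~ collinear y s -> d x s = 3.
Proof.
move=> Xz Xs yz zs ys nys.
have [//|ds] : d x s = 3 \/ d x s = 2.
  by have := outside_gdist Xs (nesym ys); tauto.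
have yz' : z <> y by case: yz => /nesym.
have dz : d x z = 2.
  apply/eqP; rewrite eqn_leq outside_gdist_ge2 // andbT.
  apply: leq_trans (gdist_triangle conn y x z) _.
  by move/(gdist1 conn): xy => ->; move/(gdist1 conn): yz => ->.
have [L [YL zL sL]] := collinear_line Xz Xs zs.
have [zs' _] := zs.
have [r rL] := closer_on_line near_unique zs' zL sL (etrans dz (esym ds)).
rewrite dz => dr; have Xr := full YL rL.
have ry : r = y.
  by apply: contrapT => /(outside_gdist_ge2 Xr); rewrite leqNgt dr.
by case: nys; split=> //; exists L; rewrite -ry.
Qed.

(** If [p] and [q] were equidistant from [x], some point of the line would be closer; but the only
    other point is [s], already at the maximal distance 3. *)
Lemma outside_flip L p q s : inc p L -> inc q L -> inc s L ->
  X p -> X q -> X s -> p <> q -> p <> s -> q <> s -> p <> y -> q <> y ->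
  d x s = 3 -> (d x q == 2) = ~~ (d x p == 2).
Proof.
move=> pL qL sL Xp Xq Xs pq ps qs py qy ds.
have [c [_ _ _ all3]] := line_points pq pL qL.
have sc : s = c by have [] := all3 s sL => // e; [case: ps|case: qs].
have [dp|dp] := outside_gdist Xp py; have [dq|dq] := outside_gdist Xq qy;
  rewrite dp dq //;
  have [r rL] := closer_on_line near_unique pq pL qL (etrans dp (esym dq));
  by have [->|->|->] := all3 r rL; rewrite -?sc ?dp ?dq ?ds.
Qed.

End Outside.

(** A point of [X] equidistant from [x] and [u] at distance 2 must be adjacent to the third point
    [v] of the line [xu], and [v], being outside [X], has at most one neighbour in [X]. *)
Lemma outside_line_near x y u w p q : ~ X x -> ~ X u -> X y -> X w ->
  collinear x y -> collinear u w -> collinear x u -> y <> w ->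
  X p -> X q -> d x p = 2 -> d u p = 2 -> d x q = 2 -> d u q = 2 -> p = q.
Proof.
move=> nXx nXu Xy Xw xy uw [xu [L [xL uL]]] yw Xp Xq xp up xq uq.
have [v [vL vx vu all3]] := line_points xu xL uL.
(* If [v] were in [X], it would be the only neighbour in [X] of both [x] and [u], so [y = v = w]. *)
have nXv : ~ X v.
  move=> Xv; apply: yw; transitivity v.
    by apply: outside_neighbour_unique nXx Xy Xv xy _; split; [exact: nesym|exists L].
  by apply: outside_neighbour_unique nXu Xv Xw _ uw; split; [exact: nesym|exists L].
have adj r : X r -> d x r = 2 -> d u r = 2 -> collinear v r.
  move=> Xr xr ur; have [|c cL] := closer_on_line (conn := conn) (x := r) near_unique xu xL uL.
    by rewrite !(gdist_sym conn r) xr ur.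
  rewrite (gdist_sym conn r x) xr ltnS leq_eqVlt gdist_sym.
  have [->|->|->] := all3 c cL; rewrite ?xr ?ur //.
  by move=> /orP[/eqP /gdist1 //|]; rewrite ltnS leqn0 => /eqP /gdist0 e; rewrite e in nXv.
exact: outside_neighbour_unique nXv Xp Xq (adj p Xp xp up) (adj q Xq xq uq).
Qed.

End Embedding.

(** * A computable model of H(2) on bit sequences, and the finite check *)

Section Bits.
Implicit Types a b c p q s w y z : bitseq.

Definition bit_add a b : bitseq := [seq u.1 (+) u.2 | u <- zip a b].

(** Over F_2 the square of X3 is X3 itself, and addition is exclusive or. *)
Definition bit_Q6 a : bool :=
  let x := nth false a in
  (x 0 && x 4) (+) (x 1 && x 5) (+) (x 2 && x 6) == x 3.

Definition bit_grassmann a b (i j : nat) : bool :=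
  (nth false a i && nth false b j) (+) (nth false a j && nth false b i).

Definition bit_tits a b : bool :=
  let p := bit_grassmann a b in
  [&& p 1 2 == p 3 4, p 5 4 == p 3 2, p 2 0 == p 3 5,
      p 6 5 == p 3 0, p 0 1 == p 3 6 & p 4 6 == p 3 1].

Fixpoint bitseqs (n : nat) : seq bitseq :=
  if n is m.+1 then [seq e :: s | e <- [:: false; true], s <- bitseqs m]
  else [:: [::]].

Definition bit_points : seq bitseq :=
  [seq a <- bitseqs 7 | (true \in a) && bit_Q6 a].

Definition bit_span a b : seq bitseq := [:: nseq 7 false; a; b; bit_add a b].

(* [if] rather than [&&]: [vm_compute] evaluates both arguments of [andb], and
   the test on [a] and [b] alone rejects almost every pair. *)
Definition bit_line a b : bool :=
  if bit_tits a b then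
    [&& a != b, all bit_Q6 (bit_span a b) &
        all (fun c => all (bit_tits c) (bit_span a b)) (bit_span a b)]
  else false.

Definition bit_nbrs a : seq bitseq := [seq b <- bit_points | bit_line a b].

(** Collinear or equal points satisfy Tits' equations, so failing [bit_tits] certifies that [s] is
    neither [y] nor collinear with it. The listed points are thus at distance 2 from [y]. *)
Definition bit_gamma2 y : seq bitseq :=
  [seq s <- flatten [seq bit_nbrs z | z <- bit_nbrs y] | ~~ bit_tits y s].

(* [Y2] stands for [bit_gamma2 y], passed so that it is computed only once. *)
Definition bit_flips (Y2 : seq bitseq) y p : seq bitseq :=
  if bit_tits y p then [::]
  else [seq q <- bit_nbrs p | ~~ bit_tits y q && (bit_add p q \in Y2)].

Definition bit_flip_walk (Y2 : seq bitseq) y (n : nat) p : seq bitseq :=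
  iter n (fun S => undup (flatten [seq bit_flips Y2 y q | q <- S])) [:: p].

(** Two distinct points in both walk sets rule out that [w] is at distance 2 from an outside
    neighbour of [y]. Testing [p != q] explicitly replaces a proof that the list has no
    repetition. *)
Definition bit_good (Y2 : seq bitseq) y w : bool :=
  let S := bit_flip_walk Y2 y 4 w in
  let S' := bit_flip_walk (bit_gamma2 w) w 4 y in
  if [seq p <- S | p \in S'] is p :: q :: _ then p != q else false.

(** Of two points [w], [w'] joined by a flip, exactly one is at distance 2 from the outside point.
    Which one is unknown, so both are tested. *)
Definition bit_check y : bool :=
  let Y2 := bit_gamma2 y in
  if [seq w <- bit_points | ~~ nilp (bit_flips Y2 y w)] is w :: _ then
    if bit_flips Y2 y w is w' :: _ then bit_good Y2 y w && bit_good Y2 y w'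
    else false
  else false.

(** All 63 points are tried, in place of an appeal to transitivity of the automorphism group. *)
Lemma bit_checkP : all bit_check bit_points.
Proof. by vm_cast_no_check (erefl true). Qed.
End Bits.

Lemma mem_bitseqs n a : (a \in bitseqs n) = (size a == n).
Proof.
elim: n a => [|n IH] [|e a] //=.
- by apply/negbTE/negP; rewrite cats0 mem_cat => /orP[] /mapP[].
- rewrite eqSS -IH cats0 mem_cat; apply/orP/idP => [[]/mapP[s ? [_ ->]]//|a_n].
  by case: e; [right | left]; exact: map_f.
Qed.

Lemma mem_bit_points a :
  (a \in bit_points) = [&& size a == 7, true \in a & bit_Q6 a].
Proof. by rewrite mem_filter mem_bitseqs andbC. Qed.

(** * From bit sequences to vectors and subspaces over F_2 *)

Section BinaryVectors.
Local Open Scope ring_scope.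
Implicit Types (a b c : bitseq) (e : bool).

Definition vec a : 'rV['F_2]_7 := \row_i (nth false a i)%:R.

Lemma F2_cases (k : 'F_2) : k = 0 \/ k = 1.
Proof. by case: k => [[|[|]]] // i; [left | right]; exact: val_inj. Qed.

Lemma F2_natr_inj (e e' : bool) : (e%:R == e'%:R :> 'F_2) = (e == e').
Proof. by case: e e' => [] []. Qed.

Lemma F2_natrD (e e' : bool) : e%:R + e'%:R = (e (+) e')%:R :> 'F_2.
Proof. by case: e e' => [] []; exact: val_inj. Qed.

Lemma F2_natrB (e e' : bool) : e%:R - e'%:R = (e (+) e')%:R :> 'F_2.
Proof. by case: e e' => [] []; exact: val_inj. Qed.

Lemma F2_natrM (e e' : bool) : e%:R * e'%:R = (e && e')%:R :> 'F_2.
Proof. by case: e e' => [] []; exact: val_inj. Qed.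

Lemma coor_vec a i : (i < 7)%N -> coor (vec a) i = (nth false a i)%:R.
Proof. by move=> i7; rewrite /coor mxE inordK. Qed.

Lemma on_Q6_vec a : on_Q6 (vec a) = bit_Q6 a.
Proof.
by rewrite /on_Q6 !coor_vec// expr2 !F2_natrM !F2_natrD F2_natr_inj andbb.
Qed.

Lemma tits_equations_vec a b : tits_equations (vec a) (vec b) = bit_tits a b.
Proof.
by rewrite /tits_equations /grassmann !coor_vec// !F2_natrM !F2_natrB !F2_natr_inj.
Qed.

Lemma vec_surj (x : 'rV['F_2]_7) : exists2 a, size a = 7%N & x = vec a.
Proof.
exists [seq x ord0 i != 0 | i <- enum 'I_7]; first by rewrite size_map size_enum_ord.
apply/rowP => i; rewrite mxE (nth_map i) ?size_enum_ord// nth_ord_enum.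
by have [->|->] := F2_cases (x ord0 i).
Qed.

Lemma vec_inj a b : size a = 7%N -> size b = 7%N -> vec a = vec b -> a = b.
Proof.
move=> sa sb /rowP eq_ab; apply: (@eq_from_nth _ false); rewrite sa ?sb // => i i7.
have := eq_ab (Ordinal i7); rewrite !mxE /= => /eqP.
by rewrite F2_natr_inj => /eqP.
Qed.

Lemma vec0 : vec (nseq 7 false) = 0.
Proof. by apply/rowP => i; rewrite !mxE nth_nseq; case: ifP. Qed.

Lemma vec_eq0 a : size a = 7%N -> (vec a == 0) = (true \notin a).
Proof.
move=> sa; apply/eqP/idP => [a0|].
  have -> : a = nseq 7 false by apply: vec_inj; rewrite ?vec0.
  by [].
move=> nt; rewrite -vec0; congr vec; rewrite -sa; apply/all_pred1P/allP => e.
by case: e => // /(negP nt).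
Qed.

Lemma vecD a b : size a = 7%N -> size b = 7%N ->
  vec (bit_add a b) = vec a + vec b.
Proof.
move=> sa sb; apply/rowP => i; rewrite !mxE F2_natrD.
by rewrite (nth_map (false, false)) ?size_zip ?sa ?sb //= nth_zip ?sa ?sb.
Qed.

Lemma is_cayley_point_vline (v : 'rV['F_2]_7) :
  is_cayley_point <[v]>%VS = (v != 0) && on_Q6 v.
Proof.
rewrite /is_cayley_point dim_vline eqb1; congr andb.
apply/forallP/idP => [/(_ v)|Qv x]; first by rewrite memv_line.
apply/implyP => /vlineP[k ->].
by have [->|->] := F2_cases k; rewrite ?scale1r // scale0r -vec0 on_Q6_vec.
Qed.

Lemma is_cayley_point_vec a : a \in bit_points -> is_cayley_point <[vec a]>%VS.
Proof.
rewrite mem_bit_points => /and3P[/eqP sa ta Qa].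
by rewrite is_cayley_point_vline vec_eq0 // ta on_Q6_vec.
Qed.

Lemma cayley_point_vec (U : {vspace 'rV['F_2]_7}) : is_cayley_point U ->
  exists2 a, a \in bit_points & U = <[vec a]>%VS.
Proof.
move=> cpU; have /andP[/eqP dU _] := cpU.
have nz : vpick U != 0 by rewrite vpick0 -dimv_eq0 dU.
have eU : U = <[vpick U]>%VS.
  by apply/esym/eqP; rewrite eqEdim dU dim_vline nz -memvE memv_pick.
have [a sa va] := vec_surj (vpick U).
move: cpU; rewrite {1}eU va is_cayley_point_vline vec_eq0 // negbK on_Q6_vec.
move=> /andP[ta Qa].
by exists a; [rewrite mem_bit_points sa ta | rewrite {1}eU va].
Qed.

(** A one-dimensional space over F_2 has a single nonzero vector. *)
Lemma vline_vec_inj a b : a \in bit_points -> b \in bit_points ->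
  <[vec a]>%VS = <[vec b]>%VS -> a = b.
Proof.
rewrite !mem_bit_points => /and3P[/eqP sa ta _] /and3P[/eqP sb _ _] eab.
apply: vec_inj => //.
have /vlineP[k ka] : vec a \in <[vec b]>%VS by rewrite -eab memv_line.
have [k0|k1] := F2_cases k; last by rewrite ka k1 scale1r.
by move/eqP: ka; rewrite k0 scale0r vec_eq0 // ta.
Qed.

Lemma bit_lineP a b : bit_line a b ->
  [/\ a <> b, {in bit_span a b, forall c, bit_Q6 c} &
      {in bit_span a b &, forall c c', bit_tits c c'}].
Proof.
rewrite /bit_line; case: ifP => // _ /and3P[/eqP ab /allP Qab /allP Tab].
by split=> // c c' /Tab /allP; apply.
Qed.

Lemma bit_add_point a b : a \in bit_points -> b \in bit_points ->
  bit_line a b -> [/\ bit_add a b \in bit_points, bit_add a b <> a & bit_add a b <> b].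
Proof.
rewrite !mem_bit_points => /and3P[/eqP sa ta _] /and3P[/eqP sb tb _].
move=> /bit_lineP[ab Qab _].
have s_ab : size (bit_add a b) = 7%N by rewrite size_map size_zip sa sb.
split.
- rewrite s_ab eqxx Qab ?inE ?eqxx ?orbT //= andbT -[_ \in _]negbK -vec_eq0 //.
  (* In characteristic 2 a vector is its own opposite, so a zero sum forces [a = b]. *)
  rewrite vecD //; apply/eqP => ab0; apply: ab; apply: vec_inj => //.
  apply/eqP; rewrite -subr_eq0 -ab0; apply/eqP; congr (_ + _).
  by apply/rowP => i; rewrite !mxE; case: nth => //; exact: val_inj.
- move/(congr1 vec); rewrite vecD // => /eqP.
  by rewrite -subr_eq0 addrC addKr vec_eq0 // tb.
- move/(congr1 vec); rewrite vecD // => /eqP.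
  by rewrite -subr_eq0 addrK vec_eq0 // ta.
Qed.

Lemma bit_line_cayley a b : a \in bit_points -> b \in bit_points ->
  bit_line a b -> is_cayley_line (<[vec a]> + <[vec b]>)%VS.
Proof.
rewrite !mem_bit_points => /and3P[/eqP sa ta _] /and3P[/eqP sb tb _].
move=> /bit_lineP[ab Qab Tab].
have mem_span x : x \in (<[vec a]> + <[vec b]>)%VS ->
    exists2 c, c \in bit_span a b & x = vec c.
  move=> /memv_addP[_ /vlineP[k ->] [_ /vlineP[l ->] ->]].
  have [->|->] := F2_cases k; have [->|->] := F2_cases l;
    rewrite ?scale0r ?scale1r ?addr0 ?add0r.
  - by exists (nseq 7 false); rewrite ?vec0 ?inE ?eqxx.
  - by exists b; rewrite ?inE ?eqxx ?orbT.
  - by exists a; rewrite ?inE ?eqxx ?orbT.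
  - by exists (bit_add a b); rewrite ?vecD ?inE ?eqxx ?orbT.
apply/and3P; split.
- have /eqP : free [:: vec a; vec b].
    rewrite free_cons span_seq1 seq1_free vec_eq0 // tb andbT.
    apply/negP => /vlineP[k ka]; have [k0|k1] := F2_cases k.
      by move/eqP: ka; rewrite k0 scale0r vec_eq0 // ta.
    by apply: ab; apply: vec_inj; rewrite // ka k1 scale1r.
  by rewrite span_cons span_seq1 => ->.
- apply/forallP => x; apply/implyP => /mem_span[c cab ->].
  by rewrite on_Q6_vec Qab.
- apply/forallP => x; apply/forallP => y; apply/implyP.
  move=> /andP[/mem_span[c cab ->] /mem_span[c' c'ab ->]].
  by rewrite tits_equations_vec Tab.
Qed.

(** The points are spanned by [u], [v] and [v - u] for a basis [u], [v] of the plane. Three points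
    per line of H(2) are what makes an embedding into lines of size 3 full. *)
Lemma H2_line_points (L : gline H2) : exists p q r : gpoint H2,
  [/\ p <> q, r <> p, r <> q & [/\ inc p L, inc q L & inc r L]].
Proof.
case: L => V /= cV; have /and3P[/eqP dV /forallP QV _] := cV.
have {}QV x : x \in V -> on_Q6 x by move=> xV; have /implyP := QV x; apply.
have nz : vpick V != 0 by rewrite vpick0 -dimv_eq0 dV.
have uV := memv_pick V; set u := vpick V in nz uV.
have /subvPn[v vV vu] : ~~ (V <= <[u]>)%VS.
  by apply/negP => /dimvS; rewrite dV dim_vline nz.
have v_neq w : w \in <[u]>%VS -> v - w != 0.
  by move=> wu; rewrite subr_eq0; apply: contra vu => /eqP ->.
have cp w : w != 0 -> w \in V -> is_cayley_point <[w]>%VS.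
  by move=> w0 wV; rewrite is_cayley_point_vline w0 QV.
have vnz : v != 0 by rewrite -(subr0 v) v_neq ?mem0v.
have uvV : v - u \in V by rewrite memvB.
have uvnz := v_neq u (memv_line u).
pose pt w w0 wV : gpoint H2 :=
  exist (fun U => is_true (is_cayley_point U)) <[w]>%VS (cp w w0 wV).
exists (pt u nz uV), (pt v vnz vV), (pt (v - u) uvnz uvV).
split=> [/(congr1 val)/= e|/(congr1 val)/= e|/(congr1 val)/= e|]; last by split; rewrite /= -memvE.
- by move: vu; rewrite e memv_line.
- have : v - u \in <[u]>%VS by rewrite -e memv_line.
  by move=> h; move: vu; rewrite -(subrK u v) memvD // memv_line.
- have /vlineP[k] : v - u \in <[v]>%VS by rewrite -e memv_line.
  have [->|->] := F2_cases k; rewrite ?scale0r ?scale1r => /eqP.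
    by rewrite (negbTE uvnz).
  by rewrite -subr_eq0 addrC addKr oppr_eq0 (negbTE nz).
Qed.

End BinaryVectors.

(** * Consequences of the finite check for an embedded copy of H(2) *)

Section BitEmbedding.
Variables (G : geometry) (X : set (gpoint G)) (Y : set (gline G)).
Hypotheses (hexG : generalized_hexagon G)
  (line3 : forall L : gline G, [set x | inc x L] #= `I_3)
  (iso : isometrically_embedded X Y)
  (full : forall L x, Y L -> inc x L -> X x).
(** [e] names the points of [X] by coordinates. Below, [bit_line] guarantees collinearity and
    failure of [bit_tits] excludes it; each test serves only in that direction. *)
Variable e : bitseq -> gpoint G.
Hypotheses (eX : forall a, a \in bit_points -> X (e a))
  (e_surj : forall x, X x -> exists2 a, a \in bit_points & x = e a)
  (e_inj : {in bit_points &, injective e})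
  (e_line : forall a b, a \in bit_points -> b \in bit_points -> bit_line a b ->
     exists L, [/\ inc (e a) L, inc (e b) L & inc (e (bit_add a b)) L])
  (e_tits : forall a b, a \in bit_points -> b \in bit_points ->
     collinear (e a) (e b) -> bit_tits a b).
Implicit Types (x u : gpoint G) (y w p q s z : bitseq).

Local Notation conn := (hexagon_connected hexG).
Local Notation d := (gdist conn).

Lemma bit_tits_refl a : bit_tits a a.
Proof.
have g0 i j : bit_grassmann a a i j = false by rewrite /bit_grassmann andbC addbb.
by rewrite /bit_tits /= !g0.
Qed.

Lemma e_neq y p : y \in bit_points -> p \in bit_points -> ~~ bit_tits y p ->
  e y <> e p.
Proof.
by move=> yP pP /negP ntits /e_inj eyp; apply: ntits; rewrite eyp // bit_tits_refl.
Qed.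

Lemma mem_bit_nbrs p q : q \in bit_nbrs p -> q \in bit_points /\ bit_line p q.
Proof. by rewrite mem_filter => /andP[]. Qed.

Lemma e_nbrs p q : p \in bit_points -> q \in bit_nbrs p -> collinear (e p) (e q).
Proof.
move=> pP /mem_bit_nbrs[qP pq]; have [L [pL qL _]] := e_line pP qP pq.
by split; [move=> /e_inj epq; case: (bit_lineP pq) => + _ _; apply; exact: epq | exists L].
Qed.

Section Outside.
Variables (x : gpoint G) (y : bitseq).
Hypotheses (nXx : ~ X x) (yP : y \in bit_points) (xy : collinear x (e y)).

Lemma bit_gamma2_gdist s : s \in bit_gamma2 y -> s \in bit_points /\ d x (e s) = 3.
Proof.
rewrite mem_filter => /andP[ntits /flatten_mapP[z yz zs]].
have [zP _] := mem_bit_nbrs yz; have [sP _] := mem_bit_nbrs zs.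
split=> //; apply: (outside_gdist3 hexG iso full nXx (eX yP) xy (eX zP) (eX sP)).
- exact: e_nbrs.
- exact: e_nbrs.
- exact: e_neq.
- by move=> /(e_tits yP sP); exact/negP.
Qed.

Lemma bit_flips_gdist p q : p \in bit_points -> q \in bit_flips (bit_gamma2 y) y p ->
  q \in bit_points /\ (d x (e q) == 2) = ~~ (d x (e p) == 2).
Proof.
move=> pP; rewrite /bit_flips; case: ifPn => // typ; rewrite mem_filter.
move=> /andP[/andP[tyq /bit_gamma2_gdist[sP ds]] /mem_bit_nbrs[qP pq]].
split=> //; have [L [pL qL sL]] := e_line pP qP pq.
have [_ sp sq] := bit_add_point pP qP pq; have [npq _ _] := bit_lineP pq.
apply: (outside_flip line3 iso full nXx (eX yP) xy pL qL sL) => //;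
  try exact: eX.
- by move/e_inj => epq; apply: npq; exact: epq.
- by move/e_inj => eps; apply: sp; rewrite -eps.
- by move/e_inj => eqs; apply: sq; rewrite -eqs.
- exact/nesym/e_neq.
- exact/nesym/e_neq.
Qed.

Lemma bit_flip_walk_gdist n p q : p \in bit_points ->
  q \in bit_flip_walk (bit_gamma2 y) y n p ->
  q \in bit_points /\ (d x (e q) == 2) = odd n (+) (d x (e p) == 2).
Proof.
move=> pP; elim: n q => [|n IH] q; first by rewrite inE => /eqP ->.
rewrite /bit_flip_walk iterS mem_undup => /flatten_mapP[r /IH[rP dr]].
by move=> /(bit_flips_gdist rP)[qP ->]; rewrite dr addNb.
Qed.

End Outside.

(** If the distance were 2, with midpoint [u], the pairs [(x, y)] and [(u, w)] would play symmetric
    roles, and the points found by [bit_good] would be at distance 2 from both [x] and [u]. *)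
Lemma bit_good_far x y w : ~ X x -> y \in bit_points -> w \in bit_points ->
  collinear x (e y) -> ~~ bit_tits y w -> bit_good (bit_gamma2 y) y w ->
  d x (e w) <> 2.
Proof.
move=> nXx yP wP xy tyw good dw.
have [u [xu /walk1 uw]] : walk 2 x (e w) by rewrite -dw; exact: gdist_walk.
have yw := e_neq yP wP tyw.
(* In [X], the neighbour [u] of [x] would be [e y], which is not collinear with [e w]. *)
have nXu : ~ X u.
  move=> Xu; move: uw.
  rewrite -(outside_neighbour_unique hexG iso full nXx (eX yP) Xu xy xu).
  by move=> /(e_tits yP wP); exact/negP.
have du : d u (e y) = 2.
  apply/eqP; rewrite eqn_leq; apply/andP; split.
    apply: leq_trans (gdist_triangle conn x u (e y)) _.
    by rewrite gdist_sym; move/(gdist1 conn): xu => ->; move/(gdist1 conn): xy => ->.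
  exact: (outside_gdist_ge2 hexG iso full nXu (eX wP) uw (eX yP) yw).
(* The length 4 is even, so [r] inherits its distance to [x] from [w] and its distance to [u] from
   [y]. *)
have near r : r \in bit_flip_walk (bit_gamma2 y) y 4 w ->
    r \in bit_flip_walk (bit_gamma2 w) w 4 y ->
    [/\ r \in bit_points, d x (e r) = 2 & d u (e r) = 2].
  move=> /(bit_flip_walk_gdist nXx yP xy wP)[rP dxr].
  move=> /(bit_flip_walk_gdist nXu wP uw yP)[_ dur].
  by split=> //; apply/eqP; rewrite ?dxr ?dur ?dw ?du.
move: good; rewrite /bit_good; cbv zeta; set S := seq.filter _ _.
have memS r : r \in S -> [/\ r \in bit_points, d x (e r) = 2 & d u (e r) = 2].
  by rewrite mem_filter => /andP[rS' rS]; exact: near.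
case: S memS => [//|p [//|q S]] memS /eqP; apply.
have [pP xp up] : [/\ p \in bit_points, d x (e p) = 2 & d u (e p) = 2].
  by apply: memS; rewrite inE eqxx.
have [qP xq uq] : [/\ q \in bit_points, d x (e q) = 2 & d u (e q) = 2].
  by apply: memS; rewrite !inE eqxx orbT.
apply: e_inj => //; exact: (outside_line_near line3 iso full nXx nXu
  (eX yP) (eX wP) xy uw xu yw (eX pP) (eX qP) xp up xq uq).
Qed.

Lemma no_outside_neighbour x (y : gpoint G) : ~ X x -> X y -> ~ collinear x y.
Proof.
move=> nXx /e_surj[a aP ->] xy; have /allP /(_ a aP) := bit_checkP.
rewrite /bit_check; cbv zeta; set W := seq.filter _ _.
have memW w : w \in W -> w \in bit_points by rewrite mem_filter => /andP[].
case: W memW => [//|w W] /(_ w); rewrite inE eqxx => /(_ isT) wP.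
case flips : (bit_flips _ a w) => [//|w' S] /andP[goodw goodw'].
have w'w : w' \in bit_flips (bit_gamma2 a) a w by rewrite flips inE eqxx.
have [w'P dw'] := bit_flips_gdist nXx aP xy wP w'w.
move: w'w; rewrite /bit_flips; case: ifPn => // taw.
rewrite mem_filter => /andP[/andP[taw' _] _].
(* Since [w'] is not at distance 2 from [x], the flip puts [w] there, which is excluded too. *)
have /eqP := bit_good_far nXx aP w'P xy taw' goodw'; rewrite dw' negbK => /eqP.
exact: (bit_good_far nXx aP wP xy taw goodw).
Qed.

End BitEmbedding.

(** * Reduction of the theorem to an outside point with a neighbour in H(2) *)

Lemma boundary_collinear (G : geometry) (X : set (gpoint G)) n x y :
  walk n x y -> ~ X x -> X y -> exists x' y', [/\ ~ X x', X y' & collinear x' y'].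
Proof.
elim: n x => [|n IH] x /=; first by move=> ->.
move=> [z [xz zy]] nXx Xy; have [Xz|nXz] := pselect (X z); first by exists x, z.
exact: IH zy nXz Xy.
Qed.

Theorem theorem4p4 :
  ~ exists (t : option nat) (G : geometry)
      (X : set (gpoint G)) (Y : set (gline G)),
      [/\ generalized_hexagon G,
          has_order G 2 t,
          isomorphic H2 (subgeometry X Y),
          isometrically_embedded X Y &
          proper_subgeometry X Y].
Proof.
move=> [t [G [X [Y [hexG [line3 _] [f [g [bf bg fg]]] iso propXY]]]]].
have [f' fK f'K] := bf; have [g' gK g'K] := bg.
have [[two_points pls] [conn _] _ _ _] := hexG.
have line_img L : Y L -> exists M : gline H2, L = val (g M).
  by move=> YL; exists (g' (exist _ L (mem_set YL))); rewrite g'K.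
(* A line of [Y] already has three points in [X], which are all its points. *)
have full L x : Y L -> inc x L -> X x.
  move=> /line_img[M ->] xM.
  have [p [q [r [pq rp rq [pM qM rM]]]]] := H2_line_points M.
  have vf_inj a b : val (f a) = val (f b) -> a = b by move=> /val_inj /(can_inj fK).
  have inM a : inc a M -> inc (val (f a)) (val (g M)) by move=> /fg.
  have [|c [_ _ _ all3]] := line_points line3 _ (inM p pM) (inM q qM).
    by move=> /vf_inj.
  have rc : val (f r) = c.
    by have [/vf_inj|/vf_inj|] := all3 _ (inM r rM).
  by have [->|->|->] := all3 x xM; rewrite -?rc; exact: set_valP.
(* If [X] were everything, each line would join two points of [X] and so be in [Y], contradicting
   properness. *)
have [x0 nXx0] : exists x, ~ X x.
  apply: contrapT => /forallNP allX; apply: propXY; split; apply/seteqP; split=> //.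
    by move=> x _; exact: contrapT (allX x).
  move=> L _; have [a [b [ab [aL bL]]]] := two_points L.
  have [|||M [YM aM bM]] := collinear_line hexG iso (a := a) (b := b).
  - exact: contrapT (allX a).
  - exact: contrapT (allX b).
  - by split=> //; exists L.
  by rewrite (pls a b L M).
(* [x0] is a default for sequences that give no point; it is never reached on [bit_points]. *)
pose e a : gpoint G :=
  if insub (<[vec a]>%VS) is Some p then val (f (p : gpoint H2)) else x0.
have eE a : a \in bit_points ->
    exists2 p : gpoint H2, val p = <[vec a]>%VS & e a = val (f p).
  move=> aP; rewrite /e insubT; first exact: is_cayley_point_vec.
  by move=> cp; exists (Sub _ cp).
have eP (p : gpoint H2) a : a \in bit_points -> val p = <[vec a]>%VS ->
    e a = val (f p).
  by move=> /eE[q qa ->] pa; congr (val (f _)); apply: val_inj; rewrite qa pa.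
have eX a : a \in bit_points -> X (e a).
  by move=> /eE[p _ ->]; exact: set_valP.
have e_surj x : X x -> exists2 a, a \in bit_points & x = e a.
  move=> Xx; pose p := f' (exist _ x (mem_set Xx)).
  have [a aP pa] := cayley_point_vec (valP p).
  by exists a => //; rewrite (eP p) // f'K.
have e_inj : {in bit_points &, injective e}.
  move=> a b aP bP; have [p pa ->] := eE a aP; have [q qb ->] := eE b bP.
  move=> /val_inj /(can_inj fK) pq; apply: vline_vec_inj => //.
  by rewrite -pa -qb pq.
have e_line a b : a \in bit_points -> b \in bit_points -> bit_line a b ->
    exists L, [/\ inc (e a) L, inc (e b) L & inc (e (bit_add a b)) L].
  move=> aP bP ab; have [sP _ _] := bit_add_point aP bP ab.
  pose M : gline H2 := exist (fun V => is_true (is_cayley_line V)) _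
    (bit_line_cayley aP bP ab).
  have on_M c : c \in bit_points -> vec c \in val M -> inc (e c) (val (g M)).
    by move=> /eE[p pc ->] cM; apply/(fg p M); rewrite /= pc -memvE.
  have aM : vec a \in val M by rewrite memvE addvSl.
  have bM : vec b \in val M by rewrite memvE addvSr.
  exists (val (g M)); split; apply: on_M => //.
  move: (aP) (bP); rewrite !mem_bit_points => /and3P[/eqP sa _ _] /and3P[/eqP sb _ _].
  by rewrite vecD // memvD.
have e_tits a b : a \in bit_points -> b \in bit_points ->
    collinear (e a) (e b) -> bit_tits a b.
  move=> aP bP ab.
  have [_ [/line_img[M ->] aM bM]] := collinear_line hexG iso (eX a aP) (eX b bP) ab.
  have mem c : c \in bit_points -> inc (e c) (val (g M)) -> vec c \in val M.
    by move=> /eE[p pc ->] /(fg p M); rewrite /= pc -memvE.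
  have /and3P[_ _ /forallP /(_ (vec a)) /forallP /(_ (vec b))] := valP M.
  by rewrite !mem // tits_equations_vec.
(* Any point of H(2) will do as the end of a walk from [x0]; the first basis vector lies on the
   quadric. *)
pose a := true :: nseq 6 false; have aP : a \in bit_points by [].
have [n xa] := conn x0 (e a).
have [x [y [nXx Xy]]] := boundary_collinear xa nXx0 (eX a aP).
exact: (no_outside_neighbour hexG line3 iso full eX e_surj e_inj e_line e_tits).
Qed.
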